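(* Let $p$ be a prime number with $p \notin \{2, 3, 7, 11, 131, 193, 599, 3541, 8009\}$, let $e \ge 0$ be an integer, and put $n = 5p^{e}$. Let $k$ be a (commutative) field of characteristic $0$ and let $P \in k[X]$ be a polynomial of degree $n$ such that, for every $i \in \{1, \dots, n-1\}$, the polynomials $P$ and $P^{(i)}$ are not coprime in $k[X]$. Then there exist $c, r \in k$ such that $P = c\,(X-r)^{n}$.
   Context: $P^{(i)}$ denotes the $i$-th formal derivative of $P$. Two polynomials in $k[X]$ are not coprime if they have a common factor of positive degree (equivalently, a common root in an algebraic closure of $k$). The Casas-Alvero conjecture in degree $n$ asserts that a one-variable polynomial of degree $n$ over a field of characteristic $0$ that is not coprime to each of its first $n-1$ derivatives has the form $c(X-r)^n$. *)

(* Defs.v *)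
From mathcomp Require Export all_boot all_order all_algebra.

Set Implicit Arguments.
Unset Strict Implicit.
Unset Printing Implicit Defensive.

(* Main.v *)
(** Over a splitting field of [P], extend the [p]-adic valuation of the
    rationals (Chevalley: a subring maximal among those in which [p] is not
    invertible is a valuation ring), and normalise the roots affinely so that
    all of them are integral and both 0 and 1 occur.  Reduction then gives a
    polynomial [Q] of degree [5 p^e] in characteristic [p], with two distinct
    roots, sharing a root with each of its Hasse derivatives.  Since [p]
    divides ['C(j, i)] when [p^e] divides [j] but not [i], the Hasse
    derivatives of order prime to [p^e] are successively constant, hence zero,
    so [Q = R(X^(p^e))]; the quintic [R] inherits the hypothesis, and an
    explicit elimination shows that it has a single root unless [p] divides
    one of the resultants met on the way. *)

Require Import Defs.
From HB Require Import structures.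
From mathcomp Require Import all_boot all_order all_algebra all_field ring zify.
From mathcomp Require Import boolp classical_sets.
Set Implicit Arguments.
Unset Strict Implicit.
Unset Printing Implicit Defensive.
Import GRing.Theory.
Local Open Scope ring_scope.

(** Apart from 2, 3 and 7, each entry arises once in the elimination: 3541, 599 and 8009 in the
    three certificates on b, 11 and 131 from b = 20 in [quintic_root_order3_neq1], 193 in
    [quintic_root_order2_neq1]. *)
Definition bad_primes : seq nat :=
  [:: 2; 3; 7; 11; 131; 193; 599; 3541; 8009]%N.

(** * Elimination for the quintic *)

Section Quintic.
Variable F : fieldType.
Hypothesis bad_neq0 : forall l, l \in bad_primes -> l%:R != 0 :> F.
Implicit Types a b c g t x y z : F.

Let n2 : 2 != 0 :> F. Proof. exact: bad_neq0. Qed.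
Let n3 : 3 != 0 :> F. Proof. exact: bad_neq0. Qed.
Let n7 : 7 != 0 :> F. Proof. exact: bad_neq0. Qed.
Let n11 : 11 != 0 :> F. Proof. exact: bad_neq0. Qed.
Let n131 : 131 != 0 :> F. Proof. exact: bad_neq0. Qed.
Let n193 : 193 != 0 :> F. Proof. exact: bad_neq0. Qed.
Let n599 : 599 != 0 :> F. Proof. exact: bad_neq0. Qed.
Let n3541 : 3541 != 0 :> F. Proof. exact: bad_neq0. Qed.
Let n8009 : 8009 != 0 :> F. Proof. exact: bad_neq0. Qed.

(* The next three lemmas are Bezout certificates for the resultants of a cubic
   in [t] with 9 - b, 16 - b and a quadratic in [b].  Large integers are written
   in base 1000 because literals are unary. *)
Lemma cubic_root_b_neq9 t :
  9 - 21 * t - t ^+ 2 + 9 * t ^+ 3 = 0 -> 30 * t - 10 * t ^+ 3 != 9.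
Proof.
move=> ht; apply/negP => /eqP hb; suff: 3 ^+ 3 * 3541 != 0 :> F.
  have -> : 3 ^+ 3 * 3541 =
    ((10 * 1000 + 170) * t ^+ 2 - 3020 * t - (25 * 1000 + 707)) *
      (9 - (30 * t - 10 * t ^+ 3)) +
    ((36 * 1000 + 330) + 2100 * t - (11 * 1000 + 300) * t ^+ 2) *
      (9 - 21 * t - t ^+ 2 + 9 * t ^+ 3) :> F by ring.
  by rewrite ht hb subrr !mulr0 addr0 eqxx.
exact: mulf_neq0 (expf_neq0 3 n3) n3541.
Qed.

Lemma cubic_root_b_neq16 t :
  9 - 21 * t - t ^+ 2 + 9 * t ^+ 3 = 0 -> 30 * t - 10 * t ^+ 3 != 16.
Proof.
move=> ht; apply/negP => /eqP hb; suff: 2 ^+ 3 * 599 != 0 :> F.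
  have -> : 2 ^+ 3 * 599 =
    (3607 - 3120 * t - 3105 * t ^+ 2) * (16 - (30 * t - 10 * t ^+ 3)) +
    (3450 * t ^+ 2 + 3850 * t - 5880) * (9 - 21 * t - t ^+ 2 + 9 * t ^+ 3)
    :> F by ring.
  by rewrite ht hb subrr !mulr0 addr0 eqxx.
exact: mulf_neq0 (expf_neq0 3 n2) n599.
Qed.

Lemma cubic_root_b_disc t (b := 30 * t - 10 * t ^+ 3) :
  9 - 21 * t - t ^+ 2 + 9 * t ^+ 3 = 0 ->
  27 * (b - 8) ^+ 2 + 112 * (b - 8) - 3136 != 0.
Proof.
move=> ht; apply/negP => /eqP hb.
(* Modulo the cubic, [9 * (b - 8)] is quadratic in t, so the condition of degree 6 in t drops to a
   quartic. *)
have hq : -6309 + 3300 * t + 2150 * t ^+ 2 - 900 * t ^+ 3 + 75 * t ^+ 4 = 0.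
  have hw : 9 * (b - 8) = 2 * (9 + 30 * t - 5 * t ^+ 2).
    apply/eqP; rewrite -subr_eq0; apply/eqP.
    transitivity (- 10 * (9 - 21 * t - t ^+ 2 + 9 * t ^+ 3)).
      by rewrite /b; ring.
    by rewrite ht mulr0.
  have n36 : 2 ^+ 2 * 3 ^+ 2 != 0 :> F := mulf_neq0 (expf_neq0 2 n2) (expf_neq0 2 n3).
  apply: (mulfI n36); rewrite mulr0.
  transitivity (27 * (9 * (b - 8)) ^+ 2 + 1008 * (9 * (b - 8)) - 9 ^+ 2 * 3136).
    by rewrite hw; ring.
  transitivity (9 ^+ 2 * (27 * (b - 8) ^+ 2 + 112 * (b - 8) - 3136)); first ring.
  by rewrite hb mulr0.
suff: 2 ^+ 2 * 3 ^+ 5 * 7 ^+ 3 * 8009 != 0 :> F.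
  have -> : 2 ^+ 2 * 3 ^+ 5 * 7 ^+ 3 * 8009 =
    (7119 * 1000 + 654 - ((11 * 1000 + 910) * 1000 + 425) * t
       - ((10 * 1000 + 582) * 1000 + 200) * t ^+ 2) *
      (-6309 + 3300 * t + 2150 * t ^+ 2 - 900 * t ^+ 3 + 75 * t ^+ 4) +
    (((5287 * 1000 + 562) * 1000 + 850)
       + ((1377 * 1000 + 898) * 1000 + 925) * t
       - ((949 * 1000 + 168) * 1000 + 125) * t ^+ 2
       + (88 * 1000 + 185) * 1000 * t ^+ 3) *
      (9 - 21 * t - t ^+ 2 + 9 * t ^+ 3) :> F by ring.
  by rewrite ht hq !mulr0 addr0 eqxx.
exact: (mulf_neq0 (mulf_neq0 (mulf_neq0 (expf_neq0 2 n2) (expf_neq0 5 n3))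
  (expf_neq0 3 n7)) n8009).
Qed.

(* The quintic X^5 - 10 X^3 + b X^2 + c X with common roots 1, t, g with its
   Hasse derivatives of order 3, 2, 1.  Dividing R = X^4 - 10 X^2 + b X + c by
   X - 1, the root t gives the cubic above, and the double root g of
   R / (X - 1) = X^3 + X^2 - 9 X - 9 + b gives the quadratic in b. *)
Lemma quintic_root_order3_neq1 t g b c :
  b = 30 * t - 10 * t ^+ 3 -> 1 - 10 + b + c = 0 ->
  t * (t ^+ 4 - 10 * t ^+ 2 + b * t + c) = 0 ->
  5 * g ^+ 4 - 30 * g ^+ 2 + 2 * b * g + c = 0 ->
  g * (g ^+ 4 - 10 * g ^+ 2 + b * g + c) = 0 -> False.
Proof.
move=> hb hc1 ht hg' hg.
have hc : c = 9 - b by rewrite -[LHS]subr0 -hc1; ring.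
have tb : [\/ b = 0, b = 20 | 9 - 21 * t - t ^+ 2 + 9 * t ^+ 3 = 0].
  have : t * (t - 1) * (9 - 21 * t - t ^+ 2 + 9 * t ^+ 3) = 0.
    rewrite -[RHS]oppr0 -ht hc hb; ring.
  move/eqP; rewrite !mulf_eq0 -orbA subr_eq0.
  case/or3P=> /eqP h; [constructor 1 | constructor 2 | by constructor 3];
    rewrite hb h; ring.
have gb : [\/ b = 9, b = 16 | 27 * (b - 8) ^+ 2 + 112 * (b - 8) - 3136 = 0].
  have [g0|gN0] := eqVneq g 0.
    by constructor 1; rewrite -[LHS]addr0 -hg' hc g0; ring.
  have [g1|gN1] := eqVneq g 1.
    by constructor 2; rewrite -[LHS]subr0 -hg' hc g1; ring.
  constructor 3; have gg : g * (g - 1) != 0 by rewrite mulf_neq0 // subr_eq0.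
  have hC : g ^+ 3 + g ^+ 2 - 9 * g - 9 + b = 0.
    by apply: (mulfI gg); rewrite mulr0 -hg hc; ring.
  have hC' : 3 * g ^+ 2 + 2 * g - 9 = 0.
    apply: (mulfI gg); rewrite mulr0.
    transitivity (5 * g ^+ 4 - 30 * g ^+ 2 + 2 * b * g + c
      - (2 * g - 1) * (g ^+ 3 + g ^+ 2 - 9 * g - 9 + b)); first by rewrite hc; ring.
    by rewrite hg' hC mulr0 subr0.
  (* Dividing 9 times the cubic by its derivative leaves a remainder linear in g, so [56 * g] can be
     substituted in the derivative; 3136 is 56 squared. *)
  have h56 : 56 * g = 9 * (b - 8).
    apply/eqP; rewrite -subr_eq0; apply/eqP.
    transitivity ((3 * g + 1) * (3 * g ^+ 2 + 2 * g - 9)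
      - 9 * (g ^+ 3 + g ^+ 2 - 9 * g - 9 + b)); first ring.
    by rewrite hC hC' !mulr0 subr0.
  have n9 : 3 ^+ 2 != 0 :> F := expf_neq0 2 n3.
  apply: (mulfI n9); rewrite mulr0.
  transitivity (3 * (9 * (b - 8)) ^+ 2 + 112 * (9 * (b - 8)) - 9 * 3136); first ring.
  rewrite -h56; transitivity (3136 * (3 * g ^+ 2 + 2 * g - 9)); first ring.
  by rewrite hC' mulr0.
case: tb => [b0|b20|cub].
- case: gb => h; move: h.
  + move=> /eqP; rewrite b0 eq_sym (_ : 9 = 3 ^+ 2); last ring.
    exact/negP/(expf_neq0 2 n3).
  + move=> /eqP; rewrite b0 eq_sym (_ : 16 = 2 ^+ 4); last ring.
    exact/negP/(expf_neq0 4 n2).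
  + move=> /eqP; rewrite b0 (_ : _ - _ = - (2 ^+ 8 * 3 ^+ 2)); last ring.
    rewrite oppr_eq0; exact/negP/(mulf_neq0 (expf_neq0 8 n2) (expf_neq0 2 n3)).
- case: gb => h; move: h.
  + move=> /eqP; rewrite b20 -subr_eq0 (_ : _ - _ = 11); last ring.
    exact/negP/n11.
  + move=> /eqP; rewrite b20 -subr_eq0 (_ : _ - _ = 2 ^+ 2); last ring.
    exact/negP/(expf_neq0 2 n2).
  + move=> /eqP; rewrite b20 (_ : _ - _ = 2 ^+ 4 * 131); last ring.
    exact/negP/(mulf_neq0 (expf_neq0 4 n2) n131).
case: gb => /eqP; rewrite hb; apply/negP.
- exact: cubic_root_b_neq9.
- exact: cubic_root_b_neq16.
- exact: cubic_root_b_disc.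
Qed.

(** This is X^5 - 10 X^2 + 9 X, the case a = 0 with the root shared with the second Hasse derivative
    scaled to 1. A double root g is nonzero, hence common to X^4 - 10 X + 9 and half its
    derivative. *)
Lemma quintic_root_order2_neq1 g :
  5 * g ^+ 4 - 20 * g + 9 = 0 -> g * (g ^+ 4 - 10 * g + 9) = 0 -> False.
Proof.
move=> hg' hg.
have [g0|gN0] := eqVneq g 0.
  have /eqP : 3 ^+ 2 = 0 :> F by rewrite -hg' g0; ring.
  exact/negP/(expf_neq0 2 n3).
have h : g ^+ 4 - 10 * g + 9 = 0 by apply: (mulfI gN0); rewrite mulr0.
have h' : 2 * g ^+ 3 - 5 = 0.
  have n2g : 2 * g != 0 by rewrite mulf_neq0.
  apply: (mulfI n2g); rewrite mulr0 -[RHS]subr0 -{1}hg' -h; ring.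
suff: 3 * 193 != 0 :> F.
  have -> : 3 * 193 = (- 144 - 120 * g - 100 * g ^+ 2) * (g ^+ 4 - 10 * g + 9)
    + (- 375 + 72 * g + 60 * g ^+ 2 + 50 * g ^+ 3) * (2 * g ^+ 3 - 5) :> F by ring.
  by rewrite h h' !mulr0 addr0 eqxx.
exact: mulf_neq0 n3 n193.
Qed.

(** Here x, y, z are roots of X^5 + a X^3 + b X^2 + c X shared with its Hasse derivatives of order
    3, 2, 1. By weighted homogeneity the first nonzero one among x and y can be scaled to 1; if both
    vanish, the equations for z reduce to 4 z^5 = 0. *)
Lemma quintic_common_roots x y z a b c :
  10 * x ^+ 2 + a = 0 -> x * (x ^+ 4 + a * x ^+ 2 + b * x + c) = 0 ->
  10 * y ^+ 3 + 3 * a * y + b = 0 -> y * (y ^+ 4 + a * y ^+ 2 + b * y + c) = 0 ->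
  5 * z ^+ 4 + 3 * a * z ^+ 2 + 2 * b * z + c = 0 ->
  z * (z ^+ 4 + a * z ^+ 2 + b * z + c) = 0 ->
  [/\ a = 0, b = 0 & c = 0].
Proof.
move=> hx' hx hy' hy hz' hz.
have ha : a = - 10 * x ^+ 2 by rewrite -[LHS]subr0 -hx'; ring.
have hb : b = 30 * x ^+ 2 * y - 10 * y ^+ 3.
  by rewrite -[LHS]subr0 -hy' ha; ring.
have [x0|xN0] := eqVneq x 0; last first.
  have x5N0 : x ^+ 5 != 0 by rewrite expf_neq0.
  exfalso; apply: (@quintic_root_order3_neq1 (y / x) (z / x) (b / x ^+ 3) (c / x ^+ 4)).
  - by rewrite hb; field.
  - by apply: (mulfI x5N0); rewrite mulr0 -[RHS]hx ha; field.
  - by apply: (mulfI x5N0); rewrite mulr0 -[RHS]hy ha; field.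
  - have x4N0 : x ^+ 4 != 0 by rewrite expf_neq0.
    by apply: (mulfI x4N0); rewrite mulr0 -[RHS]hz' ha; field.
  - by apply: (mulfI x5N0); rewrite mulr0 -[RHS]hz ha; field.
have a0 : a = 0 by rewrite ha x0; ring.
have [y0|yN0] := eqVneq y 0; last first.
  have y4N0 : y ^+ 4 != 0 by rewrite expf_neq0.
  have y5N0 : y ^+ 5 != 0 by rewrite expf_neq0.
  have {}hb : b = - 10 * y ^+ 3 by rewrite hb x0; ring.
  have hc : c = 9 * y ^+ 4.
    apply: (mulfI yN0); rewrite -[LHS]subr0 -hy hb a0; ring.
  exfalso; apply: (@quintic_root_order2_neq1 (z / y)).
  - by apply: (mulfI y4N0); rewrite mulr0 -[RHS]hz' a0 hb hc; field.
  - by apply: (mulfI y5N0); rewrite mulr0 -[RHS]hz a0 hb hc; field.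
have b0 : b = 0 by rewrite hb x0 y0; ring.
have hc : c = - 5 * z ^+ 4 by rewrite -[LHS]subr0 -hz' a0 b0; ring.
have [z0|zN0] := eqVneq z 0; first by split=> //; rewrite hc z0; ring.
case/negP: (mulf_neq0 (expf_neq0 2 n2) (expf_neq0 5 zN0)); apply/eqP.
by rewrite -[RHS]oppr0 -hz a0 b0 hc; ring.
Qed.

End Quintic.

(** * Hasse derivatives and the quintic in terms of roots *)

(** Hasse derivatives are used because the ordinary ones of order at least p vanish in
    characteristic p. Common roots are asked for in R itself since the polynomials fed in from
    characteristic 0 are split. *)
Definition casas_alvero (R : idomainType) (P : {poly R}) :=
  forall i, (0 < i < (size P).-1)%N -> exists2 r, root P r & root P^`N(i) r.

Lemma coef_comp_XaddC (R : comNzRingType) (p : {poly R}) (c : R) i :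
  (p \Po ('X + c%:P))`_i = p^`N(i).[c].
Proof.
elim/poly_ind: p i => [|p d IHp] i.
  by rewrite comp_poly0 linear0 coef0 horner0.
rewrite comp_polyD comp_polyM comp_polyX comp_polyC mulrDr.
case: i => [|i]; rewrite !coefD coefMX coefMC coefC !IHp /=.
  by rewrite nderivn0 nderivn0 add0r hornerMXaddC.
by rewrite nderivnMXaddC hornerD hornerMX addr0.
Qed.

Lemma nderivn_comp_XaddC (R : comNzRingType) (p : {poly R}) (c y : R) i :
  (p \Po ('X + c%:P))^`N(i).[y] = p^`N(i).[c + y].
Proof.
rewrite -!coef_comp_XaddC -comp_polyA comp_polyD comp_polyX comp_polyC.
by rewrite -addrA -polyCD [y + c]addrC.
Qed.

Lemma quintic_root_unique (F : fieldType) (P : {poly F}) :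
  (forall l, l \in bad_primes -> l%:R != 0 :> F) ->
  P \is monic -> size P = 6%N -> casas_alvero P ->
  forall x y, root P x -> root P y -> x = y.
Proof.
move=> badN0 Pmon sP caP.
have [|t Pt P4t] := caP 4%N; first by rewrite sP.
suff root_t x : root P x -> x = t by move=> x y /root_t-> /root_t->.
(* Moving to 0 the root shared with the fourth Hasse derivative kills the coefficients of degree 0
   and 4, even in characteristic 5. *)
pose S := P \Po ('X + t%:P).
have sS : size S = 6%N by rewrite /S size_comp_poly2 // size_XaddC.
have S0 : S`_0 = 0 by rewrite coef_comp_XaddC nderivn0 (eqP Pt).
have S4 : S`_4 = 0 by rewrite coef_comp_XaddC (eqP P4t).
have S5 : S`_5 = 1.
  have /monicP := Pmon; rewrite lead_coefE sP /= => <-.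
  rewrite coef_comp_XaddC (_ : P^`N(5%N) = (P`_5)%:P) ?hornerC //.
  apply/polyP=> i; rewrite coef_nderivn coefC; case: i => [|i] /=.
    by rewrite addn0 binn mulr1n.
  by rewrite nth_default ?mul0rn // sP.
have hornerS y : S.[y] = y * (y ^+ 4 + S`_3 * y ^+ 2 + S`_2 * y + S`_1).
  by rewrite horner_coef sS !big_ord_recr big_ord0 /= S0 S4 S5; ring.
have rootS y : root P y -> S.[y - t] = 0.
  by move=> /eqP Py; rewrite horner_comp !hornerE subrK.
have nderivS i y : root P^`N(i) y -> S^`N(i).[y - t] = 0.
  by move=> /eqP Py; rewrite nderivn_comp_XaddC addrC subrK.
have hornerNS i y : S^`N(i).[y] = \sum_(j < 6 - i) S`_(i + j) *+ 'C(i + j, i) * y ^+ j.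
  by rewrite horner_poly sS.
have [|x1 Px1 /nderivS hx1] := caP 3%N; first by rewrite sP.
have [|x2 Px2 /nderivS hx2] := caP 2%N; first by rewrite sP.
have [|x3 Px3 /nderivS hx3] := caP 1%N; first by rewrite sP.
have [S3 S2 S1] : [/\ S`_3 = 0, S`_2 = 0 & S`_1 = 0].
  apply: (quintic_common_roots badN0 (x := x1 - t) (y := x2 - t) (z := x3 - t));
    rewrite -?hornerS ?rootS //.
  - rewrite -[RHS]hx1 hornerNS !big_ord_recr big_ord0 /= S4 S5.
    rewrite (_ : 'C(3 + 0, 3) = 1%N) // (_ : 'C(3 + 2, 3) = 10%N) //; ring.
  - rewrite -[RHS]hx2 hornerNS !big_ord_recr big_ord0 /= S4 S5.
    rewrite (_ : 'C(2 + 0, 2) = 1%N) // (_ : 'C(2 + 1, 2) = 3%N) //.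
    rewrite (_ : 'C(2 + 3, 2) = 10%N) //; ring.
  - rewrite -[RHS]hx3 hornerNS !big_ord_recr big_ord0 /= S4 S5.
    rewrite (_ : 'C(1 + 0, 1) = 1%N) // (_ : 'C(1 + 1, 1) = 2%N) //.
    rewrite (_ : 'C(1 + 2, 1) = 3%N) // (_ : 'C(1 + 4, 1) = 5%N) //; ring.
move=> /rootS /eqP; rewrite hornerS S3 S2 S1 !mul0r !addr0 -exprS expf_eq0 /=.
by rewrite subr_eq0 => /eqP.
Qed.

(** * From degree m p^e to degree m in characteristic p *)

(** Since i C(j, i) = j C(j-1, i-1) is divisible by p^e, a binomial prime to p would force p^e to
    divide i. *)
Lemma dvdn_bin_pfactor p e i j : prime p ->
  (p ^ e %| j)%N -> ~~ (p ^ e %| i)%N -> (p %| 'C(j, i))%N.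
Proof.
move=> pr_p dj ndi.
case: i ndi => [|i] ndi; first by rewrite dvdn0 in ndi.
case: j dj => [|j] dj; first by rewrite bin0n.
have : (p ^ e %| i.+1 * 'C(j.+1, i.+1))%N by rewrite -mul_bin_diag dvdn_mulr.
apply: contraLR; rewrite -prime_coprime // => cop.
by rewrite Gauss_dvdl // coprimeXl.
Qed.

Section PrimeCharacteristic.
Variables (F : fieldType) (p e m : nat).
Hypothesis charFp : p \in [pchar F].
Let q := (p ^ e)%N.

Let p_prime : prime p. Proof. exact: pcharf_prime charFp. Qed.
Let q_gt0 : (0 < q)%N. Proof. by rewrite expn_gt0 prime_gt0. Qed.
Let q_pnat : [pchar F].-nat q.
Proof. by rewrite pnatX pnatE // charFp. Qed.

Variable Q : {poly F}.
Hypotheses (Qmon : Q \is monic) (sQ : size Q = (m * q).+1).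
Hypothesis caQ : casas_alvero Q.

Lemma casas_alvero_coef_eq0 i : ~~ (q %| i)%N -> Q`_i = 0.
Proof.
(* Descending induction on i, starting from the degree [m * q]. *)
have [k] := ubnP (m * q - i); elim: k i => // k IHk i le_k ndi.
have [lt_i|le_i] := ltnP (m * q) i; first by rewrite nth_default ?sQ.
have neq_i : i != (m * q)%N by apply: contraNneq ndi => ->; rewrite dvdn_mull.
have lt_i : (i < m * q)%N by rewrite ltn_neqAle neq_i.
have i_gt0 : (0 < i)%N by case: (i) ndi => //; rewrite dvdn0.
have [|r _ /eqP] := caQ (i := i); first by rewrite sQ i_gt0.
rewrite (_ : Q^`N(i) = (Q`_i)%:P) ?hornerC //.
apply/polyP=> [[|j]]; rewrite coef_nderivn coefC /= ?addn0 ?binn ?mulr1n //.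
(* A higher term of the Hasse derivative dies by its binomial if q divides its index in Q, and by
   induction otherwise. *)
have [d_ij|nd_ij] := boolP (q %| i + j.+1)%N.
  apply/eqP; rewrite -mulr_natr mulf_eq0 -(dvdn_pcharf charFp).
  by rewrite (dvdn_bin_pfactor p_prime d_ij ndi) orbT.
by rewrite IHk ?mul0rn //; lia.
Qed.

Let R := \poly_(j < m.+1) Q`_(q * j).

Lemma casas_alvero_comp_Xq : Q = R \Po 'X^q.
Proof.
apply/polyP=> i; rewrite coef_comp_poly_Xn // coef_poly.
case: ifPn => [/dvdnP[j ->]|/casas_alvero_coef_eq0//].
rewrite mulnK //; case: ltnP => [_|lt_mj]; first by rewrite mulnC.
by rewrite nth_default // sQ ltn_pmul2r.
Qed.

(** The map x to x^q carries a common root of Q and its Hasse derivative of order j q to one of [R]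
    and its Hasse derivative of order j. *)
Lemma casas_alvero_frobenius :
  exists S : {poly F}, [/\ S \is monic, size S = m.+1, casas_alvero S
    & forall x, root Q x -> root S (x ^+ q)].
Proof.
have Rm : R`_m = 1.
  rewrite coef_poly ltnSn mulnC; have /monicP := Qmon.
  by rewrite lead_coefE sQ.
have sR : size R = m.+1.
  rewrite size_poly_eq // mulnC -[X in Q`_X]/((m * q).+1.-1) -sQ -lead_coefE.
  by rewrite (monicP Qmon) oner_neq0.
have rootR x : root Q x -> root R (x ^+ q).
  by rewrite /root {1}casas_alvero_comp_Xq horner_comp hornerXn.
exists R; split=> //; first by apply/monicP; rewrite lead_coefE sR.
move=> j; rewrite sR /= => /andP[j_gt0 lt_jm].
have [|r Qr /eqP Qjr] := caQ (i := (j * q)%N).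
  by rewrite sQ /= muln_gt0 j_gt0 q_gt0 ltn_pmul2r.
exists (r ^+ q); first exact: rootR.
apply/eqP; rewrite -[RHS]Qjr -!coef_comp_XaddC [in RHS]casas_alvero_comp_Xq.
have q_pnatP : [pchar {poly F}].-nat q.
  by rewrite (eq_pnat _ (pchar_poly F)).
(* Q(X + r) = R(X^q + r^q), so no congruence between binomials is needed. *)
rewrite -comp_polyA comp_Xn_poly exprDn_pchar // -rmorphXn /=.
rewrite -['X^q + _](_ : ('X + (r ^+ q)%:P) \Po 'X^q = _); last first.
  by rewrite comp_polyD comp_polyX comp_polyC.
by rewrite comp_polyA coef_comp_poly_Xn // dvdn_mull // mulnK.
Qed.

End PrimeCharacteristic.

(** * Chevalley's theorem: maximal proper subrings are valuation rings *)

Section Chevalley.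
Variables (K : fieldType) (a : K).
Local Open Scope classical_set_scope.

Definition proper_subring (B : set K) :=
  [/\ B 1, forall x y, B x -> B y -> B (x - y),
      forall x y, B x -> B y -> B (x * y), B a & forall x, B x -> a * x != 1].

Lemma exists_maximal_proper_subring (B0 : set K) : proper_subring B0 ->
  exists2 B, proper_subring B &
    forall C, proper_subring C -> B `<=` C -> C `<=` B.
Proof.
(* Zorn is applied to the sets A through their union with B0, so that the empty chain also yields a
   proper subring. *)
move=> B0P; have [F FP Ftot|A [AP Amax]] :=
    @Zorn_bigcup K (fun A => proper_subring (B0 `|` A)).
  (* Each closure condition involves at most two elements, and these lie in one member of the
     chain. *)
  have pair x y : (B0 `|` \bigcup_(X in F) X) x -> (B0 `|` \bigcup_(X in F) X) y ->
      exists2 C, proper_subring C & [/\ C `<=` B0 `|` \bigcup_(X in F) X, C x & C y].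
    have subU X : F X -> B0 `|` X `<=` B0 `|` \bigcup_(X in F) X.
      by move=> FX z [zB|zX]; [left|right; exists X].
    move=> [Bx|[X FX Xx]] [By|[Y FY Yy]].
    - by exists B0 => //; split=> // z Bz; left.
    - by exists (B0 `|` Y); [exact: FP|split; [exact: subU|left|right]].
    - by exists (B0 `|` X); [exact: FP|split; [exact: subU|right|left]].
    have [XY|YX] := Ftot _ _ FX FY.
      exists (B0 `|` Y); [exact: FP|split; [exact: subU|right|by right]].
      exact: XY.
    exists (B0 `|` X); [exact: FP|split; [exact: subU|by right|right]].
    exact: YX.
  have [B1 _ _ Ba _] := B0P; split; try by left.
  - by move=> x y Ux Uy; have [C [_ CB _ _ _] [CU Cx Cy]] := pair x y Ux Uy;
      apply: CU; exact: CB.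
  - by move=> x y Ux Uy; have [C [_ _ CM _ _] [CU Cx Cy]] := pair x y Ux Uy;
      apply: CU; exact: CM.
  by move=> x Ux; have [C [_ _ _ _ CN] [_ Cx _]] := pair x x Ux Ux; exact: CN.
exists (B0 `|` A) => // C CP BC z Cz; right; apply: contrapT => nAz.
apply: (Amax C); last first.
  suff -> : B0 `|` C = C by [].
  by apply/seteqP; split=> [y [By|//]|y Cy]; [apply: BC; left|right].
by split=> [y Ay|/(_ z Cz)//]; apply: BC; right.
Qed.

Variable B : set K.
Hypothesis BP : proper_subring B.
Hypothesis Bmax : forall C, proper_subring C -> B `<=` C -> C `<=` B.

Let B1 : B 1. Proof. by case: BP. Qed.
Let BB x y : B x -> B y -> B (x - y). Proof. by case: BP => _ BB _ _ _; exact: BB. Qed.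
Let BM x y : B x -> B y -> B (x * y). Proof. by case: BP => _ _ BM _ _; exact: BM. Qed.
Let Ba : B a. Proof. by case: BP. Qed.
Let BN x : B x -> a * x != 1. Proof. by case: BP => _ _ _ _ BN; exact: BN. Qed.
Let B0 : B 0. Proof. by rewrite -(subrr 1); exact: BB. Qed.
Let BD x y : B x -> B y -> B (x + y).
Proof. by move=> Bx By; rewrite -[y]opprK -[- y]sub0r; do 2?[apply: BB => //]. Qed.

(** The localisation of B at 1 + aB is still proper, as a u / (1 - a v) = 1 gives a (u + v) = 1; by
    maximality it equals B. *)
Lemma maximal_subring_unit x : B x -> B (1 - a * x)^-1.
Proof.
pose C : set K := [set z | exists2 u, B u & exists2 v, B v & z = u / (1 - a * v)].
have nz v : B v -> 1 - a * v != 0 by move=> Bv; rewrite subr_eq0 eq_sym BN.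
have BC : B `<=` C.
  by move=> z Bz; exists z => //; exists 0 => //; rewrite mulr0 subr0 divr1.
have CP : proper_subring C.
  split; try exact: BC.
  - move=> _ _ [u Bu [v Bv ->]] [u' Bu' [v' Bv' ->]].
    exists (u * (1 - a * v') - u' * (1 - a * v)); first by auto.
    exists (v + v' - a * v * v'); first by auto.
    have -> : 1 - a * (v + v' - a * v * v') = (1 - a * v) * (1 - a * v') by ring.
    by field; rewrite !nz.
  - move=> _ _ [u Bu [v Bv ->]] [u' Bu' [v' Bv' ->]].
    exists (u * u'); first by auto.
    exists (v + v' - a * v * v'); first by auto.
    have -> : 1 - a * (v + v' - a * v * v') = (1 - a * v) * (1 - a * v') by ring.
    by field; rewrite !nz.
  move=> _ [u Bu [v Bv ->]]; apply: contra_neq (BN (BD Bu Bv)) => h.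
  have au : a * u = 1 - a * v.
    by rewrite -[LHS](divfK (nz v Bv)) -[a * u / _]mulrA h mul1r.
  by rewrite mulrDr au subrK.
by move=> Bx; apply: (Bmax CP BC); exists 1 => //; exists x => //; rewrite mul1r.
Qed.

Definition poly_in (f : {poly K}) := forall i, B f`_i.

(** B[x] is a subring strictly larger than B, so by maximality a must become invertible in it. *)
Lemma adjoin_not_proper x : ~ B x -> exists2 f, poly_in f & a * f.[x] = 1.
Proof.
move=> nBx; apply: contrapT => nf; apply: nBx.
pose C : set K := [set z | exists2 f, poly_in f & z = f.[x]].
have pC c : B c -> poly_in c%:P by move=> Bc i; rewrite coefC; case: ifP.
have BC : B `<=` C by move=> z Bz; exists z%:P; [exact: pC | rewrite hornerC].
apply: (Bmax _ BC).
  split; try exact: BC.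
  - move=> _ _ [f Bf ->] [g Bg ->]; exists (f - g); last by rewrite !hornerE.
    by move=> i; rewrite coefB; exact: BB.
  - move=> _ _ [f Bf ->] [g Bg ->]; exists (f * g); last by rewrite hornerM.
    by move=> i; rewrite coefM; elim/big_ind: _ => //; auto.
  by move=> _ [f Bf ->]; apply/eqP => h; apply: nf; exists f.
by exists 'X; [move=> i; rewrite coefX; case: eqP | rewrite hornerX].
Qed.

(* Chevalley's step: reversing [g] yields a relation for [x] of degree at most
   that of [f] whose leading coefficient [1 - a g_0] is a unit. *)
Lemma relation_reduction x f g : x != 0 -> poly_in f -> poly_in g ->
    a * f.[x] = 1 -> a * g.[x^-1] = 1 -> (size g <= size f)%N ->
  exists2 f', poly_in f' & a * f'.[x] = 1 /\ (size f' < size f)%N.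
Proof.
move=> x0 Bf Bg fx gx le_gf.
have neq0 (u : {poly K}) y : a * u.[y] = 1 -> u != 0.
  by apply: contra_eqN => /eqP->; rewrite horner0 mulr0 eq_sym oner_eq0.
have [f0 g0] : f != 0 /\ g != 0 by split; [exact: neq0 fx | exact: neq0 gx].
pose n := (size f).-1; pose m := (size g).-1.
have sf : size f = n.+1 by rewrite -polySpred.
have sg : size g = m.+1 by rewrite -polySpred.
have le_mn : (m <= n)%N by rewrite -ltnS -sf -sg.
pose h := \poly_(i < m.+1) g`_(m - i).
have hx : a * h.[x] = x ^+ m.
  rewrite -[RHS]mul1r -gx -mulrA; congr (_ * _).
  rewrite horner_poly horner_coef sg mulr_suml (reindex_inj rev_ord_inj) /=.
  apply: eq_bigr => i _; rewrite subSS subKn; last by rewrite -ltnS.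
  rewrite -mulrA; congr (_ * _); rewrite exprVn [RHS]mulrC.
  by rewrite -expfB_cond // (negPf x0) leq_ord.
(* By [hx], [k] vanishes at x, so subtracting a multiple of it preserves the value of f; the
   multiple chosen below cancels the term of degree n. *)
pose k := 'X^m - a *: h.
pose u := (1 - a * g`_0)^-1.
have nzu : 1 - a * g`_0 != 0 by rewrite subr_eq0 eq_sym BN.
have Bu : B u by exact: maximal_subring_unit.
have Bk i : B k`_i.
  rewrite coefB coefZ coefXn coef_poly; apply: BB; first by case: eqP.
  by apply: BM => //; case: ifP.
exists (f - (f`_n * u) *: ('X^(n - m) * k)).
  by move=> i; rewrite coefB coefZ coefXnM; apply: BB => //; apply: BM; [auto|case: ifP].
split.
  rewrite hornerD hornerN hornerZ hornerM hornerD hornerN hornerZ hx !hornerXn.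
  by rewrite subrr !mulr0 subr0.
rewrite sf ltnS; apply/leq_sizeP => j le_nj.
rewrite coefB coefZ coefXnM ltnNge (leq_trans (leq_subr _ _) le_nj) /=.
rewrite coefB coefZ coefXn coef_poly.
have [lt_nj|le_jn] := ltnP n j.
  have lt_mj : (m < j - (n - m))%N by lia.
  by rewrite nth_default ?sf // ltnNge lt_mj /= gtn_eqF // mulr0 subr0 mulr0 subr0.
have -> : j = n by apply/eqP; rewrite eqn_leq le_jn le_nj.
by rewrite subKn // eqxx ltnSn subnn -mulrA mulVf // mulr1 subrr.
Qed.

(** If x and its inverse both lay outside B, each would satisfy a relation as in
    [adjoin_not_proper]; [relation_reduction] shortens the longer one, an infinite descent on the
    total size. *)
Lemma maximal_subring_valuation x : B x \/ B x^-1.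
Proof.
apply: contrapT => /not_orP[/adjoin_not_proper[f Bf fx] nBx'].
have x0 : x != 0 by apply/eqP => x0; apply: nBx'; rewrite x0 invr0.
have /adjoin_not_proper[g Bg gx] := nBx'.
have [k] := ubnP (size f + size g).
elim: k f g Bf Bg fx gx => // k IHk f g Bf Bg fx gx lek.
have [le_gf|/ltnW le_fg] := leqP (size g) (size f).
  have [f' Bf' [fx' lt_f]] := relation_reduction x0 Bf Bg fx gx le_gf.
  by apply: (IHk f' g) => //; lia.
have x'0 : x^-1 != 0 by rewrite invr_eq0.
have [|g' Bg' [gx' lt_g]] := relation_reduction x'0 Bg Bf gx _ le_fg.
  by rewrite invrK.
by apply: (IHk f g') => //; lia.
Qed.

End Chevalley.

(** * Residue field of a valuation ring *)

Section ResidueField.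
Local Open Scope quotient_scope.
Variables (K : fieldType) (B : subringClosed K).

Definition subring_of := {x : K | x \in B}.
HB.instance Definition _ := SubChoice.on subring_of.
HB.instance Definition _ := [SubChoice_isSubComNzRing of subring_of by <:].

Hypothesis Bval : forall x, x \in B \/ x^-1 \in B.

(** Zero is listed apart because its inverse is 0 by convention, which lies in B. *)
Definition nonunits : pred subring_of :=
  fun x => (val x == 0) || ((val x)^-1 \notin B).

Lemma nonunits_mull (c x : subring_of) : nonunits x -> nonunits (c * x).
Proof.
rewrite /nonunits rmorphM /= => /orP[/eqP->|nx]; first by rewrite mulr0 eqxx.
have [//|cx0] := eqVneq (val c * val x) 0; apply: contra nx => cxB /=.
move: cx0; rewrite mulf_eq0 negb_or => /andP[c0 x0].
by rewrite -[_^-1](mulVKf c0) -invfM rpredM // (valP c).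
Qed.

(** For sums: one of u / v and v / u lies in B, so u + v is a multiple of v or of u. *)
Fact nonunits_idealr : idealr_closed nonunits.
Proof.
split=> [||c u v uN vN]; rewrite -?[_ \in _]/(nonunits _).
- by rewrite /nonunits rmorph0 eqxx.
- by rewrite /nonunits rmorph1 oner_eq0 invr1 rpred1.
have {}uN : nonunits (c * u) by exact: nonunits_mull.
move: (c * u) uN => {}u uN.
have [->|] := eqVneq u 0; first by rewrite add0r.
have [->|] := eqVneq v 0; first by rewrite addr0.
rewrite -!(inj_eq val_inj) rmorph0 => v0 u0.
have [uvB|vuB] := Bval (val u / val v).
  have -> : u + v = (Sub (val u / val v) uvB + 1) * v.
    by apply: val_inj; rewrite rmorphM !rmorphD rmorph1 /= mulrDl mul1r divfK.
  exact: nonunits_mull.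
rewrite invf_div in vuB.
have -> : u + v = (1 + Sub (val v / val u) vuB) * u.
  by apply: val_inj; rewrite rmorphM !rmorphD rmorph1 /= mulrDl mul1r divfK.
exact: nonunits_mull.
Qed.

HB.instance Definition _ := isIdealr.Build subring_of nonunits nonunits_idealr.

Let I : idealr subring_of := nonunits.
Let Q : comNzRingType := {ideal_quot I}.

Lemma residue_inv (x : Q) : exists y, x != 0 -> y * x = 1.
Proof.
elim/quotW: x => x; have [xN|xU] := boolP (nonunits x).
  exists 0; rewrite -[0](rmorph0 (\pi_Q)) -Quotient.idealrBE subr0.
  by rewrite -[_ \in _]/(nonunits _) xN.
move: xU; rewrite /nonunits negb_or negbK => /andP[x0 x'B].
exists (\pi_Q (Sub (val x)^-1 x'B)) => _.
rewrite -rmorphM -(rmorph1 (\pi_Q)); congr (\pi_Q _).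
by apply: val_inj; rewrite rmorphM rmorph1 /= mulVf.
Qed.

(** The subtype and the quotient are hidden behind [iota] and [phi], leaving only a place of K. *)
Lemma valuation_residue_field : exists (S : comNzRingType) (F : fieldType)
  (iota : {rmorphism S -> K}) (phi : {rmorphism S -> F}),
  [/\ injective iota, forall x, x \in B -> exists s, iota s = x
    & forall s, iota s != 0 -> (iota s)^-1 \notin B -> phi s = 0].
Proof.
pose inv (x : Q) : Q := if x == 0 then 0 else sval (cid (residue_inv x)).
have mulVx x : x != 0 -> inv x * x = 1.
  by move=> x0; rewrite /inv ifN //; exact: svalP (cid (residue_inv x)) x0.
have inv0 : inv 0 = 0 by rewrite /inv ifT.
pose F : fieldType := HB.pack Q (GRing.ComNzRing_isField.Build Q mulVx inv0).
exists subring_of, F, (val : {rmorphism subring_of -> K}).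
exists (\pi_Q : {rmorphism subring_of -> F}).
split; first exact: val_inj.
  by move=> x Bx; exists (Sub x Bx).
move=> s s0 s'B; apply/eqP; rewrite -(rmorph0 (\pi_Q)).
by rewrite -Quotient.idealrBE subr0 -[_ \in _]/(nonunits _) /nonunits s'B orbT.
Qed.

End ResidueField.

(** * Places of residue characteristic p, and uniqueness of the root there *)

Lemma exists_place (K : fieldType) (p : nat) : [pchar K] =i pred0 -> prime p ->
  exists (S : comNzRingType) (F : fieldType)
         (iota : {rmorphism S -> K}) (phi : {rmorphism S -> F}),
  [/\ injective iota, p \in [pchar F]
    & forall x, (exists s, iota s = x) \/ (exists s, iota s = x^-1)].
Proof.
move=> /pcharf0P char0 p_prime.
have [|B BP Bmax] :=
    @exists_maximal_proper_subring K p%:R [set x | exists z : int, x = z%:~R]%classic.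
  split; first by exists 1.
  - by move=> _ _ [y ->] [z ->]; exists (y - z); rewrite rmorphB.
  - by move=> _ _ [y ->] [z ->]; exists (y * z); rewrite rmorphM.
  - by exists p.
  move=> _ [z ->]; rewrite -[p%:R]/(p%:~R) -intrM -subr_eq0 -(intrB _ _ 1).
  have: p%:Z * z - 1 != 0.
    rewrite subr_eq0; apply/eqP => /(congr1 absz); rewrite abszM => /eqP.
    by rewrite absz_nat muln_eq1 gtn_eqF ?prime_gt1.
  case: (p%:Z * z - 1) => m; rewrite ?NegzE ?rmorphN ?oppr_eq0 /= -?pmulrn char0.
    by [].
  by [].
have [B1 BB BM Ba BN] := BP.
pose b : {pred K} := [pred x | `[< B x >]].
have b_closed : subring_closed b.
  split; first exact/asboolP.
    by move=> x y /asboolP Bx /asboolP By; apply/asboolP; exact: BB.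
  by move=> x y /asboolP Bx /asboolP By; apply/asboolP; exact: BM.
pose b' : subringClosed K := HB.pack b (GRing.isSubringClosed.Build K b b_closed).
have bval x : x \in b' \/ x^-1 \in b'.
  by have [Bx|Bx] := maximal_subring_valuation BP Bmax x; [left|right]; apply/asboolP.
have [S [F [iota [phi [iota_inj iota_onto phi0]]]]] := valuation_residue_field bval.
exists S, F, iota, phi; split=> // [|x]; last first.
  by have [/iota_onto|/iota_onto] := bval x; [left|right].
(* The image of p in F is 0 because 1 / p is not in B: p is not invertible there. *)
apply/andP; split=> //; rewrite -(rmorph_nat phi); apply/eqP/phi0.
  by rewrite rmorph_nat char0 -lt0n prime_gt0.
rewrite rmorph_nat; apply/negP => /asboolP /BN; rewrite mulfV ?eqxx //.
by rewrite char0 -lt0n prime_gt0.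
Qed.

Lemma bad_primes_prime l : l \in bad_primes -> prime l.
Proof. by move: l; apply/allP; vm_compute. Qed.

Lemma pchar_root_unique (F : fieldType) (p e : nat) (Q : {poly F}) :
    p \in [pchar F] -> p \notin bad_primes ->
    Q \is monic -> size Q = (5 * p ^ e).+1 -> casas_alvero Q ->
  forall x y, root Q x -> root Q y -> x = y.
Proof.
move=> charFp p_good Qmon sQ caQ.
have p_prime := pcharf_prime charFp.
have badN0 l : l \in bad_primes -> l%:R != 0 :> F.
  move=> l_bad; rewrite -(dvdn_pcharf charFp).
  rewrite dvdn_prime2 ?(bad_primes_prime l_bad) //.
  by apply: contra p_good => /eqP->.
have [S [Smon sS caS QS]] := casas_alvero_frobenius charFp Qmon sQ caQ.
move=> x y /QS Sx /QS Sy; have := quintic_root_unique badN0 Smon sS caS Sx Sy.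
have q_pnat : [pchar F].-nat (p ^ e)%N by rewrite pnatX pnatE // charFp.
(* Additivity of the q-th power, q = p^e, makes it injective. *)
have /esym/eqP := exprDn_pchar (x - y) y q_pnat.
rewrite subrK => + xy; rewrite xy -subr_eq0 addrK expf_eq0 subr_eq0.
by case/andP=> _ /eqP.
Qed.

(** * Normalisation of the roots and reduction *)

(** Here m is a nonzero entry of largest absolute value for the valuation, updated by comparison
    with each new head. *)
Lemma valuation_max (S : nzRingType) (K : fieldType) (iota : {rmorphism S -> K})
    (s : seq K) :
  (forall x, (exists a, iota a = x) \/ (exists a, iota a = x^-1)) ->
  has (predC1 0) s ->
  exists2 m, m \in s & m != 0 /\ forall x, x \in s -> exists a, iota a = x / m.
Proof.
move=> val_iota; elim: s => //= x s IHs.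
have [->|x0 _] /= := eqVneq x 0.
  move=> /IHs[m ms [m0 sm]]; exists m; first by rewrite inE ms orbT.
  split=> // y; rewrite inE => /orP[/eqP->|/sm//].
  by exists 0; rewrite rmorph0 mul0r.
have [/IHs[m ms [m0 sm]]|/hasPn s0] := boolP (has (predC1 0) s); last first.
  exists x; rewrite ?inE ?eqxx //; split=> // y; rewrite inE => /predU1P[->|/s0].
    by exists 1; rewrite rmorph1 divff.
  by rewrite /= negbK => /eqP->; exists 0; rewrite rmorph0 mul0r.
have [xm|[a am]] := val_iota (x / m).
  exists m; first by rewrite inE ms orbT.
  by split=> // y; rewrite inE => /predU1P[->|/sm].
exists x; rewrite ?inE ?eqxx //; split=> // y; rewrite inE => /predU1P[->|/sm[b bm]].
  by exists 1; rewrite rmorph1 divff.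
by exists (b * a); rewrite rmorphM am bm invf_div mulrA divfK.
Qed.

(** The coefficient of degree i is an elementary symmetric function, homogeneous of degree
    [size s - i]; the factor m^i on the left avoids both subtraction and division. *)
Lemma prod_XaddC_scale (K : comNzRingType) (m : K) (s : seq K) i :
  m ^+ i * (\prod_(x <- s) ('X + (m * x)%:P))`_i =
  m ^+ size s * (\prod_(x <- s) ('X + x%:P))`_i.
Proof.
elim: s i => [|x s IHs] i.
  by rewrite !big_nil coef1; case: i => [|i] //=; rewrite !mulr0.
rewrite !big_cons !mulrDl !coefD !coefXM !coefCM /= !mulrDr.
congr (_ + _); last by rewrite mulrCA IHs exprS; ring.
by case: i => [|i] /=; rewrite ?mulr0 // !exprS -!mulrA IHs.
Qed.

Lemma nderivn_prod_XsubC (K : comNzRingType) (s : seq K) r i :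
  (\prod_(x <- s) ('X - x%:P))^`N(i).[r] = (\prod_(x <- s) ('X + (r - x)%:P))`_i.
Proof.
rewrite -coef_comp_XaddC; congr (polyseq _)`_i; rewrite rmorph_prod.
apply: eq_bigr => x _ /=.
by rewrite comp_polyB comp_polyX comp_polyC polyCB addrA.
Qed.

Lemma casas_alvero_5_primepow_roots (K : fieldType) (p e : nat) (s : seq K) :
    [pchar K] =i pred0 -> prime p -> p \notin bad_primes ->
    size s = (5 * p ^ e)%N -> casas_alvero (\prod_(x <- s) ('X - x%:P)) ->
  forall x y, x \in s -> y \in s -> x = y.
Proof.
move=> charK p_prime p_good sz_s ca x0 y0 x0s y0s; apply/eqP; apply: contraT => neq_xy.
have [S [F [iota [phi [iota_inj charFp val_iota]]]]] := exists_place charK p_prime.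
(* Dividing the differences from x0 by the largest one, m = x1 - x0, makes all roots integral and
   sends x0 to 0 and x1 to 1. *)
have [|m /mapP[x1 x1s m_def] [m0 sm]] :=
    valuation_max (s := [seq x - x0 | x <- s]) val_iota.
  by apply/hasP; exists (y0 - x0); [exact: map_f | rewrite /= subr_eq0 eq_sym].
pose f x := (x - x0) / m.
have [g gE] : exists g : K -> S, forall x, x \in s -> iota (g x) = f x.
  have h x : exists a, x \in s -> iota a = f x.
    have [xs|_] := boolP (x \in s); last by exists 0.
    by have [a] := sm _ (map_f _ xs); exists a.
  by exists (fun x => sval (cid (h x))) => x; exact: svalP (cid (h x)).
pose Q := \prod_(a <- map g s) ('X - a%:P).
pose Qb := \prod_(a <- map (phi \o g) s) ('X - a%:P).
have QbE : Qb = map_poly phi Q.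
  rewrite /Q rmorph_prod /Qb !big_map; apply: eq_bigr => x _.
  by rewrite /= map_polyXsubC.
have sQb : size Qb = (5 * p ^ e).+1 by rewrite size_prod_XsubC size_map sz_s.
have Qbmon : Qb \is monic by exact: monic_prod_XsubC.
have caQb : casas_alvero Qb.
  move=> i; rewrite sQb => /andP[i0 lt_i].
  have [|r] := ca i; first by rewrite size_prod_XsubC sz_s i0.
  rewrite root_prod_XsubC => rs /eqP ri.
  exists (phi (g r)); first by rewrite root_prod_XsubC; exact: (map_f (phi \o g)).
  (* The vanishing is checked in K, through the injective [iota], and then pushed to F by [phi]. *)
  rewrite QbE nderivn_map /root horner_map -(rmorph0 phi); apply/eqP; congr (phi _).
  apply: iota_inj; rewrite rmorph0 -horner_map -nderivn_map /= gE //.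
  rewrite rmorph_prod big_map (eq_big_seq (fun x => 'X - (f x)%:P)); last first.
    by move=> x xs; rewrite /= map_polyXsubC gE.
  rewrite -(big_map f xpredT (fun y => 'X - y%:P)) nderivn_prod_XsubC big_map.
  have mi0 : m ^+ size s != 0 by rewrite expf_neq0.
  have mi'0 : m ^+ i != 0 by rewrite expf_neq0.
  apply: (mulfI mi0); rewrite mulr0 -{1}(size_map (fun x => f r - f x) s).
  rewrite -(big_map (fun x => f r - f x) xpredT (fun y => 'X + y%:P)).
  rewrite -prod_XaddC_scale big_map; apply/eqP; rewrite mulf_eq0 (negPf mi'0) /=.
  apply/eqP; rewrite -[RHS]ri nderivn_prod_XsubC; congr (polyseq _)`_i.
  apply: eq_bigr => x _; congr ('X + _%:P); rewrite /f; field.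
  by [].
have [gx0 gx1] : g x0 = 0 /\ g x1 = 1.
  split; apply: iota_inj; rewrite gE // /f ?rmorph0 ?rmorph1.
    by rewrite subrr mul0r.
  by rewrite -m_def divff.
have := pchar_root_unique charFp p_good Qbmon sQb caQb.
move=> /(_ (phi (g x0)) (phi (g x1))) /=.
(* A single root of [Qb] would give 0 = 1 in F. *)
rewrite gx0 gx1 rmorph0 rmorph1 !root_prod_XsubC => /(_ _ _)/eqP.
rewrite eq_sym oner_eq0 -{1}(rmorph0 phi) -(rmorph1 phi) -gx0 -gx1.
by apply; exact: (map_f (phi \o g)).
Qed.

(** * Splitting fields and descent to the ground field *)

Lemma exists_irreducible_divisor (K : fieldType) (P : {poly K}) :
  (1 < size P)%N -> exists2 q, irreducible_poly q & q %| P.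
Proof.
have [n] := ubnP (size P); elim: n P => // n IHn P; rewrite ltnS => le_Pn P_gt1.
have P0 : P != 0 by rewrite -size_poly_gt0 ltnW.
have [irr|nirr] := pselect (irreducible_poly P); first by exists P.
have [q [q1 qP nqP]] : exists q : {poly K}, [/\ size q != 1%N, q %| P & ~~ (q %= P)].
  apply: contrapT => nq; apply: nirr; split=> // q q1 qP.
  by apply: contrapT => /negP nqP; apply: nq; exists q.
have q0 : q != 0 by apply: contraNneq P0 => q0; rewrite q0 dvd0p in qP.
have lt_qP : (size q < size P)%N.
  rewrite ltn_neqAle dvdp_leq // andbT.
  by apply: contraNneq nqP => eq_qP; rewrite -dvdp_size_eqp // eq_qP.
have [||r r_irr rq] := IHn q; first exact: leq_trans lt_qP _.
  by rewrite ltn_neqAle eq_sym q1 size_poly_gt0.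
by exists r => //; exact: dvdp_trans qP.
Qed.

(** Adjoin a root of an irreducible factor and split off its linear factor; the field grows, so the
    induction on size quantifies over K. *)
Lemma exists_splitting (K : fieldType) (P : {poly K}) : P != 0 ->
  exists (L : fieldType) (f : {rmorphism K -> L}) (s : seq L),
    map_poly f P = lead_coef (map_poly f P) *: \prod_(x <- s) ('X - x%:P).
Proof.
have [n] := ubnP (size P); elim: n K P => // n IHn K P; rewrite ltnS => le_Pn P0.
have [P_le1|P_gt1] := leqP (size P) 1.
  exists K, (idfun : {rmorphism K -> K}), [::]; rewrite map_poly_id // big_nil.
  by rewrite {1}(size1_polyC P_le1) alg_polyC lead_coefE -subn1
    (eqP (_ : _ - 1 == 0)%N) ?subn_eq0.
have [q q_irr qP] := exists_irreducible_divisor P_gt1.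
have [L _ [z qz _]] := irredp_FAdjoin q_irr.
pose f : {rmorphism K -> L} := in_alg L.
have [Q PQ] : exists Q, map_poly f P = Q * ('X - z%:P).
  apply/factor_theorem; rewrite -dvdp_XsubCl.
  by apply: (@dvdp_trans _ (map_poly f q)); rewrite ?dvdp_XsubCl ?dvdp_map.
have fP0 : map_poly f P != 0 by rewrite map_poly_eq0.
have Q0 : Q != 0 by apply: contraNneq fP0 => Q0; rewrite PQ Q0 mul0r.
have [|M [g [s Qs]]] := IHn L Q _ Q0.
  apply: leq_trans le_Pn; rewrite -(size_map_poly f) PQ size_Mmonic ?monicXsubC //.
  by rewrite size_XsubC addn2.
exists M, (g \o f : {rmorphism K -> M}), (g z :: s).
rewrite map_poly_comp PQ rmorphM /= map_polyXsubC lead_coef_Mmonic ?monicXsubC //.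
by rewrite big_cons mulrC {1}Qs scalerAr.
Qed.

Lemma not_coprime_prod_XsubC (K : fieldType) (s : seq K) (Q : {poly K}) :
  ~~ coprimep (\prod_(x <- s) ('X - x%:P)) Q -> exists2 r, r \in s & root Q r.
Proof.
elim: s => [|x s IHs]; first by rewrite big_nil coprime1p.
rewrite big_cons coprimepMl negb_and => /orP[|/IHs[r rs Qr]].
  by rewrite coprimep_sym coprimep_XsubC negbK => Qx; exists x; rewrite ?mem_head.
by exists r; rewrite // inE rs orbT.
Qed.

Theorem proposition2 (p : nat) (hp : prime p)
    (hp_excl : p \notin [:: 2; 3; 7; 11; 131; 193; 599; 3541; 8009]%N)
    (e n : nat) (hn : n = (5 * p ^ e)%N)
    (k : fieldType) (hk : [pchar k] =i pred0)
    (P : {poly k}) (hP : size P = n.+1)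
    (hcop : forall i : nat, (1 <= i <= n.-1)%N -> ~~ coprimep P P^`(i)) :
  exists c r : k, P = c *: ('X - r%:P) ^+ n.
Proof.
have P0 : P != 0 by rewrite -size_poly_gt0 hP.
have n_gt0 : (0 < n)%N by rewrite hn muln_gt0 expn_gt0 (prime_gt0 hp).
have [L [f [s Ps]]] := exists_splitting P0.
set c := lead_coef _ in Ps; set Q := \prod_(x <- s) _ in Ps.
have c0 : c != 0 by rewrite /c lead_coef_eq0 map_poly_eq0.
have charL : [pchar L] =i pred0 by move=> l; rewrite (fmorph_pchar f) hk.
have sz_s : size s = n.
  by apply: succn_inj; rewrite -hP -(size_map_poly f) Ps size_scale // size_prod_XsubC.
have caQ : casas_alvero Q.
  move=> i; rewrite size_prod_XsubC sz_s => /andP[i_gt0 lt_in].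
  have [|r rs ri] := @not_coprime_prod_XsubC _ s Q^`(i).
    have := hcop i; rewrite i_gt0 -ltnS prednK // => /(_ lt_in).
    rewrite -(coprimep_map f) -derivn_map Ps derivnZ.
    by rewrite coprimepZl // coprimepZr.
  exists r; first by rewrite root_prod_XsubC.
  (* The ordinary derivative is i! times the Hasse derivative, and i! is nonzero in characteristic
     0. *)
  move: ri; rewrite /root nderivn_def hornerMn -mulr_natr mulf_eq0.
  by rewrite ((pcharf0P L).1 charL) -[X in _ || X]negbK -lt0n fact_gt0 orbF.
have s_eq := casas_alvero_5_primepow_roots charL hp hp_excl (etrans sz_s hn) caQ.
have [t st] : exists t, s = nseq n t.
  rewrite -sz_s; case: (s) s_eq => [|t s'] s_eq; first by exists 0.
  exists t; apply/all_pred1P/allP => x xs.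
  by rewrite /= (s_eq x t) ?mem_head.
have Qt : Q = ('X - t%:P) ^+ n by rewrite /Q st big_nseq iter_mulr_1.
(* The root t descends to k: the coefficient of X^(n-1) in c (X - t)^n is - n c t, and n is
   invertible. *)
pose r := - P`_n.-1 / (lead_coef P * n%:R).
have nN0 : n%:R != 0 :> L by rewrite ((pcharf0P L).1 charL) -lt0n.
have cE : c = f (lead_coef P) by rewrite /c lead_coef_map.
have fr : f r = t.
  have -> : f r = - (map_poly f P)`_n.-1 / (c * n%:R).
    by rewrite coef_map cE fmorph_div rmorphN rmorphM rmorph_nat.
  rewrite Ps coefZ -{1}sz_s coefPn_prod_XsubC ?sz_s -?lt0n // st big_nseq.
  rewrite iter_addr_0 -mulr_natr; field.
  by rewrite nN0.
exists (lead_coef P), r; apply: (map_poly_inj f).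
by rewrite Ps Qt map_polyZ /= rmorphXn /= map_polyXsubC fr -cE.
Qed.
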